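(* Let $A\in\mathbb{C}^{n\times n}$ be a (sparse) Hermitian matrix with all eigenvalues contained in the interval $(-1,1)$, and let $\mu\in\mathbb{R}$. For any $\alpha>0$, $\sigma>0$, let $$\rho=(1+\alpha\sigma)^{-1},\qquad K=\frac{2}{\rho\alpha\sigma}e^{\alpha^2}.$$ Then for all $i,j\in\{1,\dots,n\}$ with $d(i,j)\ge 1$, $$|f_{\sigma,\mu}(A)_{ij}|\le K\rho^{d(i,j)},$$ where $d(i,j)$ is the geodesic distance between the vertices $i$ and $j$ in the graph induced by $A$.
   Context: $f_{\sigma,\mu}(z)=e^{-\frac{(z-\mu)^2}{\sigma^2}}$, and $f_{\sigma,\mu}(A)$ is the corresponding matrix function of the Hermitian matrix $A$ (via its eigen-decomposition). The word ''sparse'' is descriptive and imposes no formal condition. A Hermitian matrix $A$ induces an undirected graph $G=(\mathcal{V},\mathcal{E})$ with $\mathcal{V}=\{1,\dots,n\}$ and $\mathcal{E}=\{(i,j): A_{ij}\neq 0,\ 1\le i,j\le n\}$. A path linking $i$ and $j$ is a sequence of edges $(i_0,i_1),(i_1,i_2),\dots,(i_l,i_{l+1})$ in $\mathcal{E}$ with $i_0=i$, $i_{l+1}=j$; its length is $l+1$. The geodesic distance $d(i,j)$ is the length of a shortest path linking $i$ and $j$; $d(i,i)=0$; and $d(i,j)=\infty$ if $i\ne j$ and there is no path, in which case $\rho^{d(i,j)}$ is read as $0$. *)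

(* Defs.v *)
From mathcomp Require Import all_boot all_order all_algebra.
From mathcomp Require Export complex.
From mathcomp Require Import all_classical all_reals all_analysis.

Set Implicit Arguments.
Unset Strict Implicit.
Unset Printing Implicit Defensive.
Import Order.TTheory GRing.Theory Num.Theory.
Local Open Scope ring_scope.
Local Open Scope complex_scope.

Definition cexp (R : realType) (z : R[i]) : R[i] :=
  (expR (complex.Re z))%:C * (cos (complex.Im z) +i* sin (complex.Im z)).

Definition gauss (R : realType) (sigma mu : R) (z : R[i]) : R[i] :=
  cexp (- ((z - mu%:C) ^+ 2 / (sigma%:C) ^+ 2)).

(* Meaningful for normal A (orthomx_spectralP).  The library picks one unitary
   eigen-decomposition of A; matfunE shows that any other gives the same
   value. *)
Definition matfun (C : numClosedFieldType) (n : nat) (f : C -> C)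
    (A : 'M[C]_n) : 'M[C]_n :=
  invmx (spectralmx A) *m diag_mx (map_mx f (spectral_diag A))
    *m spectralmx A.

Lemma matfunE (C : numClosedFieldType) (n : nat) (f : C -> C)
    (A P : 'M[C]_n) (d : 'rV[C]_n) :
  P \in unitmx -> A = invmx P *m diag_mx d *m P ->
  A \is normalmx -> matfun f A = invmx P *m diag_mx (map_mx f d) *m P.
Proof.
move=> Pu AP /orthomx_spectralP; rewrite /matfun.
set S := spectralmx A; set s := spectral_diag A => AS.
have Su : S \in unitmx by exact: spectral_unit.
pose Q := P *m invmx S.
have QE : diag_mx d *m Q = Q *m diag_mx s.
  have E : P *m A *m invmx S = P *m A *m invmx S by [].
  rewrite {1}AP {1}AS in E.
  by rewrite !mulmxA mulmxV // mul1mx mulmxK // in E; rewrite /Q mulmxA E.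
have QfE : diag_mx (map_mx f d) *m Q = Q *m diag_mx (map_mx f s).
  apply/matrixP => i j; move/matrixP/(_ i j): QE.
  rewrite !mul_diag_mx !mul_mx_diag !mxE => /eqP.
  rewrite mulrC -subr_eq0 -mulrBr mulf_eq0 => /orP[/eqP->|].
    by rewrite mulr0 mul0r.
  by rewrite subr_eq0 => /eqP->; rewrite mulrC.
have PQ : P = Q *m S by rewrite /Q mulmxKV.
by rewrite {2}PQ mulmxA -(mulmxA (invmx P)) QfE /Q !mulmxA mulVmx // mul1mx.
Qed.

Definition induced_edge (C : fieldType) (n : nat) (A : 'M[C]_n) : rel 'I_n :=
  fun i j => A i j != 0.

Definition linked_in (T : finType) (e : rel T) (x y : T) (l : nat) : bool :=
  [exists p : l.-tuple T, path e x p && (last x p == y)].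

(* None stands for an infinite distance. *)
Definition geodist (T : finType) (e : rel T) (x y : T) : option nat :=
  if x == y then Some 0%N else
  match pselect (exists l, linked_in e x y l) with
  | left ex_l => Some (ex_minn ex_l)
  | right _ => None
  end.

Definition geq_enat (d : option nat) (m : nat) : bool :=
  if d is Some k then (m <= k)%N else true.

(* x to the power d, read as 0 when d is infinite. *)
Definition pow_enat (R : nzRingType) (x : R) (d : option nat) : R :=
  if d is Some k then x ^+ k else 0.

(* Main.v *)
Require Import Defs.
From mathcomp Require Import all_boot all_order all_algebra.
From mathcomp Require Import separable cyclic cyclotomic.
From mathcomp Require Import all_classical all_reals all_analysis.
From mathcomp Require Import zify ring lra.
Import Order.TTheory GRing.Theory Num.Theory.
Local Open Scope ring_scope.
Local Open Scope complex_scope.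

(** The entry [(i, j)] of [A ^+ l] is a sum over walks of length [l] from [i]
to [j], so [p(A)] vanishes there as soon as [deg p < d(i,j)].  As [A] is
unitarily diagonalizable, [|f(A)_ij| <= max |f - p|] over the spectrum, hence
over [-1, 1], for each such [p]: the theorem is a statement on polynomial
approximation of the Gaussian with degree [d(i,j) - 1].

Bernstein's theorem supplies it.  The Joukowski map [w |-> (w + 1/w) / 2] sends
the circle of radius [chi > 1] onto an ellipse with foci [-1] and [1]; if [f] is
analytic inside that ellipse and [|f| <= M] on it, the [k]-th Chebyshev
coefficient of [f] is at most [2 M chi^-k], and truncating the Chebyshev
expansion after degree [d] costs at most [2 M / (chi^d (chi - 1))].  With
[chi = 1 + alpha sigma = 1/rho], points of the ellipse have imaginary part at
most [(chi - 1/chi)/2 <= alpha sigma], and [|exp(-(z - mu)^2/sigma^2)|] is at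
most [exp((Im z)^2/sigma^2) <= exp(alpha^2)].

Complex analysis is avoided by proving Bernstein's theorem for polynomials only
([bernstein_approximation]): there the Chebyshev expansion is finite and
Cauchy's estimate ([cauchy_coef_bound]) is an average over roots of unity.  It
is applied to [q_m(z) = (1 - ((z - mu)/sigma)^2 / m)^m].  The inequality
[1 + x <= exp x] alone shows both that [|q_m| <= exp(alpha^2 + T^2/m)] on the
ellipse ([gauss_poly_ellipse_le]) and that [q_m] is within [T^2/m] of the
Gaussian on [-1, 1] ([gauss_poly_interval_approx]), where [T] bounds
[|(z - mu)/sigma|^2] on the ellipse and the interval.  Letting [m] tend to
infinity gives the constant of the theorem.  When [i] and [j] are not connected,
[q_m(A)_ij = 0] for all [m], and the same limit gives [f(A)_ij = 0]. *)

(** * Cauchy's estimate for polynomials *)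

Lemma closed_prim_root_exists (C : numClosedFieldType) (n : nat) :
  (0 < n)%N -> exists z : C, n.-primitive_root z.
Proof.
move=> n_gt0; pose p : {poly C} := 'X^n - 1.
have [r Dp] := closed_field_poly_normal p.
rewrite (monicP _) ?monicXnsubC // scale1r in Dp.
have rn1 : all n.-unity_root r by apply/allP => z; rewrite -root_prod_XsubC -Dp.
have sz_r : (n < (size r).+1)%N.
  by rewrite -(size_prod_XsubC r id) -Dp size_XnsubC.
suff /(has_prim_root n_gt0 rn1)/(_ sz_r)/hasP[z _] : uniq r by exists z.
by rewrite -separable_prod_XsubC -Dp separable_Xn_sub_1 // pnatr_eq0 -lt0n.
Qed.

Lemma prim_root_sum_expr (F : fieldType) (n m : nat) (z : F) :
  n.-primitive_root z -> \sum_(j < n) (z ^+ j) ^+ m = (n %| m)%:R *+ n.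
Proof.
move=> zn; under eq_bigr do rewrite exprAC.
have zmn : (z ^+ m) ^+ n = 1 by rewrite exprAC (prim_expr_order zn) expr1n.
case: (boolP (n %| m)%N) => [/dvdnP[k ->]|ndvd].
  rewrite mulnC exprM (prim_expr_order zn) expr1n.
  by under eq_bigr do rewrite expr1n; rewrite sumr_const card_ord.
have /eqP := subrX1 (z ^+ m) n; rewrite zmn subrr eq_sym mulf_eq0 subr_eq0.
by rewrite -(prim_order_dvd zn) (negPf ndvd) mul0rn => /eqP.
Qed.

(** Averaging [p(r z^j) z^(-jk)] over the powers of a primitive [N]-th root of
unity [z] isolates the coefficient of degree [k] once [N > deg p]. *)
Lemma cauchy_coef_bound (C : numClosedFieldType) (p : {poly C}) (r M : C)
    (k : nat) :
  0 <= r -> (forall w, `|w| = r -> `|p.[w]| <= M) -> `|p`_k| * r ^+ k <= M.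
Proof.
move=> r_ge0 pM; pose N := maxn (size p) k.+1.
have N_gt0 : (0 < N)%N by rewrite leq_max orbT.
have kN : (k < N)%N by rewrite leq_max leqnn orbT.
have [z zN] := closed_prim_root_exists C N N_gt0.
have nz j : `|z ^+ j| = 1.
  rewrite normrX (_ : `|z| = 1) ?expr1n //; apply/eqP.
  by rewrite -(@pexpr_eq1 _ _ N) // -normrX (prim_expr_order zN) normr1.
(* The factor [z^(-jk)] is written [z^(j(N - k))], to stay in [nat]. *)
have avg : \sum_(j < N) p.[r * z ^+ j] * (z ^+ j) ^+ (N - k)
           = (p`_k * r ^+ k) *+ N.
  pose a j l := p`_l * (r * z ^+ j) ^+ l * (z ^+ j) ^+ (N - k).
  transitivity (\sum_(j < N) \sum_(l < N) a j l).
    apply: eq_bigr => j _.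
    by rewrite (horner_coef_wide _ (leq_maxl _ _ : size p <= N)%N) mulr_suml.
  have aE l : \sum_(j < N) a j l = p`_l * r ^+ l * ((N %| l + (N - k))%:R *+ N).
    rewrite -(@prim_root_sum_expr _ _ _ z) // mulr_sumr; apply: eq_bigr => j _.
    by rewrite /a exprMn -!mulrA -exprD.
  rewrite exchange_big /= (bigD1 (Ordinal kN)) //= aE subnKC 1?ltnW // dvdnn.
  rewrite mulrnAr mulr1 [X in _ + X]big1 ?addr0 // => l lk.
  rewrite aE (_ : (N %| _)%N = false) ?mul0rn ?mulr0 //.
  apply/negbTE; apply: contra lk => /dvdnP[q lq]; apply/eqP/val_inj => /=.
  have := ltn_ord l; move: lq kN; case: q => [|[|q]]; nia.
rewrite -(ler_pMn2r N_gt0) -(ger0_norm (exprn_ge0 k r_ge0)) -normrM.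
rewrite -normrMn -avg.
apply: (le_trans (ler_norm_sum _ _ _)).
rewrite -[X in _ *+ X]card_ord -sumr_const; apply: ler_sum => j _.
rewrite normrM normrX nz expr1n mulr1; apply: pM.
by rewrite normrM nz mulr1 ger0_norm.
Qed.

(** * Chebyshev expansion and Bernstein's theorem *)

Fixpoint chebyshev (R : comNzRingType) (k : nat) : {poly R} :=
  match k with
  | 0 => 1
  | k'.+1 => if k' is k''.+1
             then 2%:R *: ('X * chebyshev R k') - chebyshev R k'' else 'X
  end.

Lemma chebyshevSS (R : comNzRingType) k :
  chebyshev R k.+2 = 2%:R *: ('X * chebyshev R k.+1) - chebyshev R k.
Proof. by []. Qed.

Lemma chebyshev_joukowski (F : numFieldType) (k : nat) (w : F) : w != 0 ->
  (chebyshev F k).[(w + w^-1) / 2%:R] = (w ^+ k + w ^- k) / 2%:R.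
Proof.
move=> w0; set x := (w + w^-1) / 2%:R.
suff: (chebyshev F k).[x] = (w ^+ k + w ^- k) / 2%:R /\
  (chebyshev F k.+1).[x] = (w ^+ k.+1 + w ^- k.+1) / 2%:R by case.
rewrite {}/x.
elim: k => [|k [IH1 IH2]].
  by rewrite /= hornerC hornerX !expr0 !expr1; split => //; field.
split=> //; rewrite chebyshevSS hornerD hornerN hornerZ hornerM hornerX.
rewrite IH2 IH1 !exprS.
have wk : w ^+ k != 0 by rewrite expf_neq0.
by field; rewrite w0 wk.
Qed.

Lemma size_chebyshev (R : comNzRingType) k : (size (chebyshev R k) <= k.+1)%N.
Proof.
suff: (size (chebyshev R k) <= k.+1)%N /\ (size (chebyshev R k.+1) <= k.+2)%N
  by case.
elim: k => [|k [IH1 IH2]]; first by rewrite /= size_poly1 size_polyX.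
split=> //; rewrite chebyshevSS (leq_trans (size_polyD _ _)) //.
rewrite geq_max size_polyN.
rewrite (leq_trans IH1) ?(leq_trans (size_scale_leq _ _)) //; last by lia.
rewrite mulrC; apply: leq_trans (size_polyMleq _ _) _.
by rewrite size_polyX addn2.
Qed.

Lemma chebyshev_coef_neq0 (F : numFieldType) k : (chebyshev F k)`_k != 0.
Proof.
case: k => [|k]; first by rewrite coef1 oner_eq0.
suff -> : (chebyshev F k.+1)`_k.+1 = 2%:R ^+ k by rewrite expf_neq0 ?pnatr_eq0.
elim: k => [|k IH]; first by rewrite coefX.
rewrite chebyshevSS coefB coefZ coefXM /= IH -exprS.
by rewrite [X in _ - X]nth_default ?subr0 // (leq_trans (size_chebyshev _ _)).
Qed.

(** The polynomials [T_k] have exact degree [k], so subtracting a multiple of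
[T_N] kills the coefficient of degree [N]. *)
Lemma chebyshev_expansion (F : numFieldType) (N : nat) (q : {poly F}) :
  (size q <= N)%N -> exists c : nat -> F, q = \sum_(k < N) c k *: chebyshev F k.
Proof.
elim: N q => [|N IH] q sz.
  by exists (fun=> 0); rewrite big_ord0; apply/eqP; rewrite -size_poly_leq0.
pose a := q`_N / (chebyshev F N)`_N.
have [|c Dc] := IH (q - a *: chebyshev F N).
  apply/leq_sizeP => j; rewrite leq_eqVlt coefB coefZ => /orP[/eqP <-|Nj].
    by rewrite mulfVK ?subrr // chebyshev_coef_neq0.
  rewrite !nth_default ?mulr0 ?subr0 //.
    exact: leq_trans (size_chebyshev _ _) Nj.
  exact: leq_trans sz Nj.
exists (fun k => if k == N then a else c k).
rewrite big_ord_recr /= eqxx; apply/eqP; rewrite -subr_eq Dc; apply/eqP.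
by apply: eq_bigr => k _; rewrite ltn_eqF.
Qed.

(** A point of [-1, 1] is the Joukowski image of a point of the unit circle. *)
Lemma chebyshev_norm_le1 (C : numClosedFieldType) k (x : C) :
  -1 <= x <= 1 -> `|(chebyshev C k).[x]| <= 1.
Proof.
move=> /andP[x1 x2]; have xr : x \is Num.real by rewrite (ler_real x2) real1.
have s0 : 0 <= 1 - x ^+ 2.
  have -> : 1 - x ^+ 2 = (1 - x) * (x - -1) by ring.
  by rewrite mulr_ge0 ?subr_ge0.
pose s := sqrtC (1 - x ^+ 2).
have sr : s \is Num.real by rewrite ger0_real // sqrtC_ge0.
pose w := x + 'i * s; pose w' := x - 'i * s.
have ww : w * w' = 1.
  have -> : w * w' = x ^+ 2 - 'i ^+ 2 * s ^+ 2 by rewrite /w /w'; ring.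
  by rewrite sqrCi sqrtCK; ring.
have w0 : w != 0.
  by apply: contra_eq_neq ww => ->; rewrite mul0r eq_sym oner_eq0.
have Dw' : w^-1 = w' by rewrite -[LHS]mulr1 -ww mulKf.
have nw : `|w| = 1.
  apply/eqP; rewrite -(@pexpr_eq1 _ _ 2) //; apply/eqP.
  by rewrite normC2_rect // sqrtCK; ring.
have -> : x = (w + w^-1) / 2%:R by rewrite Dw' /w /w'; field.
rewrite chebyshev_joukowski // normrM normfV normr_nat ler_pdivrMr // mul1r.
apply: le_trans (ler_normD _ _) _.
by rewrite normfV normrX nw expr1n invr1.
Qed.

(** The approximant is the truncated Chebyshev expansion of [q]; the tail is
dominated by the geometric series of the coefficient bounds [2 M chi^-k]. *)
Lemma bernstein_approximation (C : numClosedFieldType) (q : {poly C})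
    (chi M : C) (d : nat) :
  1 < chi -> (forall w, `|w| = chi -> `|q.[(w + w^-1) / 2%:R]| <= M) ->
  exists2 p : {poly C}, (size p <= d.+1)%N &
    forall x, -1 <= x <= 1 ->
      `|q.[x] - p.[x]| <= 2%:R * M / (chi ^+ d * (chi - 1)).
Proof.
move=> chi1 qM; have chi0 : 0 < chi := lt_trans ltr01 chi1.
have chin0 : chi != 0 by rewrite gt_eqF.
have [N qN dN] : exists2 N, (size q <= N)%N & (d.+1 <= N)%N.
  by exists (maxn (size q) d.+1); rewrite ?leq_maxl ?leq_maxr.
have [c Dq] := chebyshev_expansion _ _ _ qN.
have c_le k : (0 < k < N)%N -> `|c k| <= 2%:R * M * chi ^- k.
  case/andP => k0 kN.
  (* [w^N q((w + 1/w)/2)] is a polynomial in [w], and its coefficient of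
     degree [N + k] is [c_k / 2] because [k > 0]. *)
  pose G := \sum_(l < N) (c l / 2%:R) *: ('X^(N + l) + 'X^(N - l)) : {poly C}.
  have Gw w : `|w| = chi -> G.[w] = w ^+ N * q.[(w + w^-1) / 2%:R].
    move=> nw; have w0 : w != 0 by rewrite -normr_gt0 nw.
    rewrite /G {1}Dq !horner_sum mulr_sumr; apply: eq_bigr => l _.
    rewrite hornerZ hornerD !hornerXn hornerZ chebyshev_joukowski // exprD.
    rewrite expfB_cond ?(negPf w0) ?add0n ?(ltnW (ltn_ord l)) //.
    by field; rewrite expf_neq0.
  have Gk : G`_(N + k) = c k / 2%:R.
    rewrite /G coef_sum (bigD1 (Ordinal kN)) //= big1 ?addr0 => [|l lk].
      by rewrite coefZ coefD !coefXn eqxx gtn_eqF ?addr0 ?mulr1 //; lia.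
    rewrite coefZ coefD !coefXn eqn_add2l eq_sym (negPf (lk : (l != k :> nat))).
    by rewrite gtn_eqF ?addr0 ?mulr0 //; lia.
  have GM w : `|w| = chi -> `|G.[w]| <= chi ^+ N * M.
    by move=> nw; rewrite Gw // normrM normrX nw ler_pM2l ?exprn_gt0 ?qM.
  have := cauchy_coef_bound _ _ _ _ (N + k) (ltW chi0) GM.
  rewrite Gk exprD normrM normfV normr_nat.
  rewrite mulrCA ler_pM2l ?exprn_gt0 // => H.
  rewrite ler_pdivlMr ?exprn_gt0 //.
  by rewrite -ler_pdivrMl // mulrA [_^-1 * _]mulrC.
exists (\sum_(0 <= k < d.+1) c k *: chebyshev C k).
  apply: (leq_trans (size_sum _ _ _)).
  rewrite big_mkord; apply/bigmax_leqP => k _.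
  by rewrite (leq_trans (size_scale_leq _ _)) ?(leq_trans (size_chebyshev _ _)).
move=> x x1; rewrite {1}Dq -(big_mkord xpredT (fun k => c k *: chebyshev C k)).
rewrite (big_cat_nat (leq0n _) dN) //= hornerD addrAC subrr add0r horner_sum.
apply: le_trans (ler_norm_sum _ _ _) _.
have M0 : 0 <= M.
  by apply: le_trans (normr_ge0 _) (qM chi _); rewrite ger0_norm // ltW.
(* Since [1/chi^k = (1/chi^(k-1) - 1/chi^k) / (chi - 1)], the geometric tail
   telescopes. *)
apply: (@le_trans _ _ (\sum_(d.+1 <= k < N) 2%:R * M / (chi - 1) *
    (chi ^- k.-1 - chi ^- k))).
  rewrite !big_nat; apply: ler_sum => k /andP[dk kN].
  rewrite hornerZ normrM.
  have -> : 2%:R * M / (chi - 1) * (chi ^- k.-1 - chi ^- k)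
            = 2%:R * M * chi ^- k.
    case: k dk {kN} => // k _; rewrite /= exprS; field.
    by rewrite chin0 expf_neq0 // subr_eq0 gt_eqF.
  rewrite -[leRHS]mulr1 ler_pM ?chebyshev_norm_le1 //.
  by rewrite c_le // kN (leq_trans _ dk).
rewrite -mulr_sumr; case: N dN {qN Dq c_le} => // N; rewrite ltnS => dN.
rewrite big_add1 /=.
rewrite (eq_bigr (fun k => - (chi ^- k.+1) - - (chi ^- k))); last first.
  by move=> k _; rewrite opprK addrC.
rewrite telescope_sumr // opprK [_^-1 in leRHS]invfM mulrA.
rewrite [leRHS]mulrAC ler_wpM2l //.
  by rewrite divr_ge0 ?mulr_ge0 ?subr_ge0 // ltW.
by rewrite gerDr oppr_le0 invr_ge0 exprn_ge0 // ltW.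
Qed.

(** * Matrix functions and walks in the induced graph *)

Lemma geodist_not_linked (T : finType) (e : rel T) (x y : T) (l : nat) :
  geq_enat (geodist e x y) l.+1 -> ~~ linked_in e x y l.
Proof.
rewrite /geodist; case: eqP => // _; case: pselect => [ex_l|no_l] /=.
  case: ex_minnP => m _ min_m lm; apply: contraTN lm => /min_m.
  by rewrite -leqNgt.
by move=> _; apply/negP => xyl; apply: no_l; exists l.
Qed.

Lemma linked_in_cons (T : finType) (e : rel T) (x y z : T) (l : nat) :
  e x z -> linked_in e z y l -> linked_in e x y l.+1.
Proof.
move=> xz /existsP[p /andP[zp lp]]; apply/existsP; exists [tuple of z :: p].
by rewrite /= xz zp.
Qed.

Section MatrixFunction.
Context {C : numClosedFieldType} {n : nat}.
Implicit Types (A : 'M[C]_n) (f g : C -> C).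

Lemma matfun_entry f A i j :
  matfun f A i j = \sum_k invmx (spectralmx A) i k * f (spectral_diag A 0 k) *
                          spectralmx A k j.
Proof.
by rewrite /matfun mxE; apply: eq_bigr => k _; rewrite mul_mx_diag !mxE.
Qed.

Lemma matfunB f g A i j :
  matfun f A i j - matfun g A i j = matfun (fun x => f x - g x) A i j.
Proof.
rewrite !matfun_entry -sumrB; apply: eq_bigr => k _; ring.
Qed.

Lemma matfun_horner (p : {poly C}) A i j :
  matfun (horner p) A i j
  = \sum_(l < size p) p`_l * matfun (fun x => x ^+ l) A i j.
Proof.
under [RHS]eq_bigr => l _ do rewrite matfun_entry mulr_sumr.
rewrite exchange_big matfun_entry; apply: eq_bigr => k _ /=.
rewrite horner_coef mulr_sumr mulr_suml; apply: eq_bigr => l _; ring.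
Qed.

(** Relates [matfun], defined by a spectral decomposition, to products by [A],
which follow the edges of the graph. *)
Lemma matfun_exprS l A : A \is normalmx ->
  matfun (fun x => x ^+ l.+1) A = A *m matfun (fun x => x ^+ l) A.
Proof.
move=> /orthomx_spectralP AE; rewrite /matfun; set S := spectralmx A in AE *.
have Su : S \in unitmx by exact: spectral_unit.
rewrite {2}AE !mulmxA mulmxK // -(mulmxA (invmx S) (diag_mx _) (diag_mx _)).
congr (_ *m _ *m _); rewrite mulmx_diag; congr diag_mx.
by apply/rowP => k; rewrite !mxE exprS.
Qed.

(** In [A ^+ l.+1 i j = \sum_k A i k * A ^+ l k j], a nonzero [A i k] is an edge
that would extend a walk from [k] to [j]. *)
Lemma matfun_expr_not_linked l A i j : A \is normalmx ->
  ~~ linked_in (induced_edge A) i j l -> matfun (fun x => x ^+ l) A i j = 0.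
Proof.
move=> Anormal; elim: l i => [|l IHl] i nlink.
  have ij : i != j.
    apply: contra nlink => /eqP ->; apply/existsP; exists [tuple].
    by rewrite /= eqxx.
  rewrite /matfun (_ : map_mx _ _ = const_mx 1); last first.
    by apply/rowP => k; rewrite !mxE expr0.
  by rewrite diag_const_mx mulmx1 mulVmx ?spectral_unit // mxE (negPf ij).
rewrite matfun_exprS // mxE big1 // => k _.
have [->|Aik] := eqVneq (A i k) 0; first by rewrite mul0r.
rewrite IHl ?mulr0 //; apply: contra nlink; exact: linked_in_cons.
Qed.

Lemma matfun_horner_far (p : {poly C}) A i j : A \is normalmx ->
  geq_enat (geodist (induced_edge A) i j) (size p) ->
  matfun (horner p) A i j = 0.
Proof.
move=> Anormal far; rewrite matfun_horner big1 // => l _.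
rewrite matfun_expr_not_linked ?mulr0 // geodist_not_linked //.
by case: geodist far => //= k; apply: leq_trans.
Qed.

(** Columns of the unitary matrix have norm 1, so by the arithmetic-geometric
mean inequality the weights of the values of [f] have moduli of total sum at
most 1. *)
Lemma matfun_norm_le f A eps i j :
  (forall k, `|f (spectral_diag A 0 k)| <= eps) -> `|matfun f A i j| <= eps.
Proof.
move=> feps; have eps0 : 0 <= eps := le_trans (normr_ge0 _) (feps i).
set S := spectralmx A; have SU : S \is unitarymx by exact: spectral_unitarymx.
have col1 (h : 'I_n) : \sum_k `|S k h| ^+ 2 = 1.
  have /matrixP/(_ h h) : invmx S *m S = 1%:M by rewrite mulVmx ?spectral_unit.
  rewrite !mxE eqxx => SS; transitivity (true%:R : C) => //; rewrite -SS.
  apply: eq_bigr => k _.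
  by rewrite invmx_unitary // !mxE normCK mulrC.
have -> : eps = \sum_k eps * ((`|S k i| ^+ 2 + `|S k j| ^+ 2) / 2%:R).
  by rewrite -mulr_sumr -mulr_suml big_split /= !col1; field.
rewrite matfun_entry (le_trans (ler_norm_sum _ _ _)) //.
apply: ler_sum => k _; rewrite -/S invmx_unitary // !mxE !normrM norm_conjC.
rewrite mulrAC mulrC ler_pM ?mulr_ge0 // ler_pdivlMr // -subr_ge0.
have -> : `|S k i| ^+ 2 + `|S k j| ^+ 2 - `|S k i| * `|S k j| * 2%:R
          = (`|S k i| - `|S k j|) ^+ 2 by ring.
by rewrite real_exprn_even_ge0 // rpredB.
Qed.

Lemma spectral_diag_eigenvalue A k :
  A \is normalmx -> eigenvalue A (spectral_diag A 0 k).
Proof.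
move=> /orthomx_spectralP; set S := spectralmx A => AE.
have Su : S \in unitmx by exact: spectral_unit.
apply/eigenvalueP; exists (row k S).
  rewrite -row_mul {1}AE !mulmxA mulmxV // mul1mx row_mul.
  by rewrite row_diag_mx -scalemxAl -rowE.
apply/eqP => Sk0; have /rowP/(_ k) : row k (S *m invmx S) = 0.
  by rewrite row_mul Sk0 mul0mx.
by rewrite mulmxV // !mxE eqxx => /eqP; rewrite oner_eq0.
Qed.

End MatrixFunction.

(** * Polynomial approximation of the Gaussian *)

Lemma gauss_real (R : realType) (sigma mu x : R) :
  gauss sigma mu x%:C = (expR (- ((x - mu) / sigma) ^+ 2))%:C.
Proof.
rewrite /gauss (_ : - ((_ - mu%:C) ^+ 2 / _) = (- ((x - mu) / sigma) ^+ 2)%:C).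
  by rewrite /cexp /= cos0 sin0 mulr1.
by rewrite rmorphN rmorphXn fmorph_div rmorphB exprMn exprVn.
Qed.

Definition gauss_poly {R : realType} (sigma mu : R) (m : nat) : {poly R[i]} :=
  (1 - (m%:R^-1 / sigma%:C ^+ 2) *: ('X - (mu%:C)%:P) ^+ 2) ^+ m.

Lemma horner_gauss_poly (R : realType) (sigma mu : R) (m : nat) (z : R[i]) :
  (gauss_poly sigma mu m).[z]
  = (1 - ((z - mu%:C) / sigma%:C) ^+ 2 / m%:R) ^+ m.
Proof.
rewrite horner_exp hornerD hornerN hornerC hornerZ horner_exp hornerXsubC.
by rewrite exprMn exprVn mulrC mulrCA mulrC.
Qed.

(** Expand [|1 + v/m|^2 = 1 + 2 Re v / m + |v|^2 / m^2], which [1 + x <= exp x]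
bounds by [exp(2 Re v / m + |v|^2 / m^2)]. *)
Lemma norm_1Ddiv_expr_le (R : realType) (v : R[i]) (a T : R) (m : nat) :
  (0 < m)%N -> complex.Re v <= a -> `|v| <= T%:C ->
  `|1 + v / m%:R| ^+ m <= (expR (a + T ^+ 2 / m%:R))%:C.
Proof.
move=> m0 va vT; have mgt0 : 0 < m%:R :> R by rewrite ltr0n.
have T0 : 0 <= T by rewrite -ler0c (le_trans _ vT).
have vT2 : complex.Re v ^+ 2 + complex.Im v ^+ 2 <= T ^+ 2.
  by rewrite -lecR add_Re2_Im2 rmorphXn lerXn2r ?nnegrE ?normr_ge0 ?ler0c.
rewrite -(@ler_pXn2r _ 2) ?nnegrE ?exprn_ge0 ?normr_ge0 ?ler0c ?expR_ge0 //.
rewrite exprAC -add_Re2_Im2 -!rmorphXn lecR -expRM_natl.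
have -> : 2%:R * (a + T ^+ 2 / m%:R)
          = m%:R * (2%:R * (a / m%:R + T ^+ 2 / m%:R ^+ 2)).
  by field; rewrite gt_eqF.
rewrite expRM_natl lerXn2r ?nnegrE ?expR_ge0 ?addr_ge0 ?sqr_ge0 //.
apply: le_trans (expR_ge1Dx _).
have -> : v / m%:R = (complex.Re v / m%:R) +i* (complex.Im v / m%:R).
  case: v {va vT vT2} => x y.
  rewrite -[m%:R in LHS](rmorph_nat (real_complex R)).
  by rewrite -fmorphV; simpc.
case: v va vT vT2 => x y /= va vT vT2.
have : x / m%:R <= a / m%:R by rewrite ler_pM2r ?invr_gt0.
have : (x ^+ 2 + y ^+ 2) / m%:R ^+ 2 <= T ^+ 2 / m%:R ^+ 2.
  by rewrite ler_pM2r ?invr_gt0 ?exprn_gt0.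
have : 0 <= T ^+ 2 / m%:R ^+ 2 by rewrite divr_ge0 ?sqr_ge0.
rewrite add0r; set M := m%:R.
have -> : (1 + x / M) ^+ 2 + (y / M) ^+ 2
          = 1 + 2 * (x / M) + (x ^+ 2 + y ^+ 2) / M ^+ 2.
  by field; rewrite gt_eqF.
lra.
Qed.

Lemma bernoulli_ineq (R : realDomainType) (s : R) (m : nat) :
  0 <= s <= 1 -> 1 - s *+ m <= (1 - s) ^+ m.
Proof.
move=> /andP[s0 s1]; elim: m => [|m IH]; first by rewrite expr0 mulr0n subr0.
rewrite exprS; apply: le_trans (ler_wpM2l _ IH); last by rewrite subr_ge0.
rewrite mulrSr -mulr_natr; have : 0 <= s * s * m%:R by rewrite !mulr_ge0.
lra.
Qed.

(** With [s = t/m], the bounds [exp(-s) (1 - s^2) <= 1 - s <= exp(-s)] are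
raised to the power [m], using Bernoulli's inequality on the left. *)
Lemma expRN_approx (R : realType) (t : R) (m : nat) :
  (0 < m)%N -> 0 <= t <= m%:R ->
  `|expR (- t) - (1 - t / m%:R) ^+ m| <= t ^+ 2 / m%:R.
Proof.
move=> m0 /andP[t0 tm]; have mgt0 : 0 < m%:R :> R by rewrite ltr0n.
set s := t / m%:R; have s0 : 0 <= s by rewrite divr_ge0.
have s1 : s <= 1 by rewrite ler_pdivrMr // mul1r.
have -> : - t = m%:R * - s by rewrite /s; field; rewrite gt_eqF.
have -> : t ^+ 2 / m%:R = s ^+ 2 *+ m.
  by rewrite /s -mulr_natr; field; rewrite gt_eqF.
rewrite expRM_natl.
have e0 := expR_ge0 (- s).
have e1 : expR (- s) <= 1 by rewrite expR_le1 oppr_le0.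
have up : (1 - s) ^+ m <= expR (- s) ^+ m.
  by rewrite lerXn2r ?nnegrE ?subr_ge0 // expR_ge1Dx.
have lo1 : expR (- s) * (1 - s ^+ 2) <= 1 - s.
  have -> : 1 - s ^+ 2 = (1 + s) * (1 - s) by ring.
  rewrite mulrA -[leRHS]mul1r ler_wpM2r ?subr_ge0 //.
  by rewrite expRN ler_pdivrMl ?expR_gt0 // mulr1 expR_ge1Dx.
have s2 : 0 <= s ^+ 2 <= 1 by rewrite sqr_ge0 expr_le1.
have : expR (- s) ^+ m * (1 - s ^+ 2 *+ m) <= (1 - s) ^+ m.
  apply: le_trans (_ : expR (- s) ^+ m * (1 - s ^+ 2) ^+ m <= _).
    by rewrite ler_wpM2l ?exprn_ge0 // bernoulli_ineq.
  rewrite -exprMn lerXn2r ?nnegrE ?subr_ge0 // mulr_ge0 // subr_ge0.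
  by case/andP: s2.
have em1 : expR (- s) ^+ m <= 1 by rewrite exprn_ile1.
have : expR (- s) ^+ m * (s ^+ 2 *+ m) <= s ^+ 2 *+ m.
  by rewrite -[leRHS]mul1r ler_wpM2r // mulrn_wge0 ?sqr_ge0.
rewrite ger0_norm ?subr_ge0 //; lra.
Qed.

(** For [w = a + ib] on the circle of radius [chi], the imaginary part is
[b (1 - chi^-2) / 2], at most [(chi - 1/chi) / 2], and [chi + 1/chi >= 2]. *)
Lemma joukowski_ellipse (R : realType) (chi : R) (w : R[i]) :
  1 < chi -> `|w| = chi%:C ->
  `|complex.Im ((w + w^-1) / 2%:R)| <= chi - 1 /\
  `|(w + w^-1) / 2%:R| <= chi%:C.
Proof.
move=> chi1 nw; have chi0 : 0 < chi by lra.
have ci1 : chi^-1 <= 1 by rewrite invf_le1 // ltW.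
have cci : chi * chi^-1 = 1 by rewrite mulfV ?gt_eqF.
split; last first.
  rewrite normrM normfV normr_nat ler_pdivrMr //.
  apply: le_trans (ler_normD _ _) _; rewrite normfV nw.
  rewrite -fmorphV -(rmorph_nat (real_complex R)) -rmorphD -rmorphM lecR; lra.
rewrite invc_norm nw -rmorphXn -!fmorphV.
rewrite -[2%:R in X in `|X|](rmorph_nat (real_complex R)).
have := add_Re2_Im2 w; rewrite nw -rmorphXn => /complexI.
case: w {nw} => a b /= ab.
simpc => /=; set c := chi^-1.
have -> : (b - chi ^- 2 * b) * (2 / (2 ^+ 2 + 0 ^+ 2)) = b * ((1 - c ^+ 2) / 2).
  by rewrite /c; field; rewrite gt_eqF.
have c0 : 0 <= c by rewrite invr_ge0 ltW.
have c2 : 0 <= (1 - c ^+ 2) / 2 by rewrite divr_ge0 // subr_ge0 expr_le1.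
have b_chi : `|b| <= chi.
  rewrite -(ger0_norm (ltW chi0)) -ler_sqr ?nnegrE // !real_normK ?num_real //.
  by rewrite -ab lerDr sqr_ge0.
rewrite normrM (ger0_norm c2) (le_trans (ler_wpM2r c2 b_chi)) //.
have -> : chi * ((1 - c ^+ 2) / 2) = (chi - c) / 2.
  by rewrite /c; field; rewrite gt_eqF.
have : 2 <= chi + c.
  by have := sqr_ge0 (chi - 1); rewrite /c in cci *; nra.
lra.
Qed.

(** The real part of [- ((z - mu)/sigma)^2] is at most [(Im z / sigma)^2], and
[Im z] is at most [chi - 1 = alpha sigma] on the ellipse. *)
Lemma gauss_poly_ellipse_le (R : realType) (sigma mu alpha : R) (m : nat)
    (w : R[i]) :
  let chi := 1 + alpha * sigma in
  let T := ((chi + `|mu|) / sigma) ^+ 2 in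
  0 < alpha -> 0 < sigma -> (0 < m)%N -> `|w| = chi%:C ->
  `|(gauss_poly sigma mu m).[(w + w^-1) / 2%:R]|
    <= (expR (alpha ^+ 2 + T ^+ 2 / m%:R))%:C.
Proof.
move=> chi T alpha0 sigma0 m0 nw.
have chi1 : 1 < chi by rewrite ltrDl mulr_gt0.
have [] := joukowski_ellipse _ _ _ chi1 nw.
set z := (w + w^-1) / 2%:R => Imz nz.
rewrite horner_gauss_poly normrX -mulNr; apply: norm_1Ddiv_expr_le => //.
  case: (z) Imz => x y.
  rewrite [complex.Im _]/= /chi addrAC subrr add0r => y_le.
  rewrite -fmorphV; simpc; rewrite [complex.Re _]/=.
  have : (y / sigma) ^+ 2 <= alpha ^+ 2.
    rewrite -real_normK ?num_real // lerXn2r ?nnegrE ?(ltW alpha0) //.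
    by rewrite normrM normfV (gtr0_norm sigma0) ler_pdivrMr.
  have := sqr_ge0 ((x - mu) / sigma).
  rewrite !expr2; nra.
have main : `|(z - mu%:C) / sigma%:C| <= ((chi + `|mu|) / sigma)%:C.
  have sigmaC0 : 0 < sigma%:C :> R[i] by rewrite ltcR.
  rewrite normrM normfV (gtr0_norm sigmaC0) fmorph_div ler_pM2r ?invr_gt0 //.
  rewrite (le_trans (ler_normB _ _)) // rmorphD lerD //.
  by rewrite normc_def /= expr0n addr0 sqrtr_sqr.
rewrite normrN normrX rmorphXn lerXn2r ?nnegrE ?normr_ge0 //.
exact: le_trans (normr_ge0 _) main.
Qed.

Lemma gauss_poly_interval_approx (R : realType) (sigma mu chi x : R) (m : nat) :
  let T := ((chi + `|mu|) / sigma) ^+ 2 in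
  0 < sigma -> 1 <= chi -> -1 <= x <= 1 -> (0 < m)%N -> T <= m%:R ->
  `|gauss sigma mu x%:C - (gauss_poly sigma mu m).[x%:C]|
    <= (T ^+ 2 / m%:R)%:C.
Proof.
move=> T sigma0 chi1 x1 m0 Tm; set t := ((x - mu) / sigma) ^+ 2.
have tT : t <= T.
  rewrite /t /T -real_normK ?num_real // lerXn2r ?nnegrE //.
    by rewrite divr_ge0 ?addr_ge0 // ?(ltW sigma0) // (le_trans _ chi1).
  rewrite normrM normfV (gtr0_norm sigma0) ler_pM2r ?invr_gt0 //.
  rewrite (le_trans (ler_normB _ _)) // lerD2r (le_trans _ chi1) //.
  by rewrite ler_norml.
have t0 : 0 <= t by rewrite sqr_ge0.
rewrite gauss_real horner_gauss_poly -/t.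
have -> : (1 - ((x%:C - mu%:C) / sigma%:C) ^+ 2 / m%:R) ^+ m
          = ((1 - t / m%:R) ^+ m)%:C :> R[i].
  rewrite rmorphXn rmorphB rmorph1 fmorph_div rmorph_nat rmorphXn.
  by rewrite fmorph_div rmorphB.
rewrite -rmorphB normc_def /= expr0n addr0 sqrtr_sqr lecR.
apply: le_trans (expRN_approx _ _ _ m0 _) _; first by rewrite t0 (le_trans tT).
by rewrite ler_pM2r ?invr_gt0 ?ltr0n // lerXn2r ?nnegrE ?(le_trans t0).
Qed.

(** * Passage to the limit *)

Lemma ler_of_harmonic (R : realType) (a b c D : R) :
  (forall m : nat, (0 < m)%N -> c <= m%:R -> a <= b + D / m%:R) -> a <= b.
Proof.
move=> H; apply/ler_addgt0Pr => e e0.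
pose x := `|c| + `|D| / e.
have x0 : 0 <= x by rewrite addr_ge0 ?divr_ge0 // ltW.
have := archi_boundP x0; set m := Num.bound x => xm.
have m0 : 0 < m%:R :> R := le_lt_trans x0 xm.
have cm : c <= m%:R.
  rewrite (le_trans (ler_norm c)) // (le_trans _ (ltW xm)) //.
  by rewrite lerDl divr_ge0 // ltW.
apply: le_trans (H m _ cm) _; first by rewrite -(ltr0n R).
rewrite lerD2l ler_pdivrMr // -ler_pdivrMl // mulrC.
rewrite (le_trans _ (ltW xm)) // /x (le_trans _ (_ : `|D| / e <= _)) ?lerDr //.
by rewrite ler_pM2r ?invr_gt0 // ler_norm.
Qed.

Lemma expR_le_1D2x (R : realType) (x : R) :
  0 <= x <= 2^-1 -> expR x <= 1 + 2 * x.
Proof.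
move=> /andP[x0 x2]; have := expR_ge1Dx (- x); rewrite expRN => H.
have e0 := expR_gt0 x.
have : expR x * (1 - x) <= 1 by rewrite -ler_pdivlMl // mulr1.
nra.
Qed.

Lemma ler_of_exp_harmonic (R : realType) (a b e T : R) :
  0 <= b -> 0 <= T ->
  (forall m : nat, (0 < m)%N -> T <= m%:R ->
     a <= T ^+ 2 / m%:R + b * expR (e + T ^+ 2 / m%:R)) ->
  a <= b * expR e.
Proof.
move=> b0 T0 H; set y := b * expR e.
(* For such [m] the argument [x = T^2/m] is at most 1/2, hence
   [exp x <= 1 + 2x]. *)
apply: (ler_of_harmonic _ _ _ (T + 2 * T ^+ 2) ((1 + 2 * y) * T ^+ 2))
  => m m0 cm.
have mgt0 : 0 < m%:R :> R by rewrite ltr0n.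
have T2 := sqr_ge0 T; have y0 : 0 <= y by rewrite mulr_ge0 ?expR_ge0.
have Tm : T <= m%:R by lra.
apply: le_trans (H m m0 Tm) _; rewrite expRD mulrA -/y -mulrA.
set x := T ^+ 2 / m%:R.
have x0 : 0 <= x <= 2^-1.
  by rewrite divr_ge0 //= ler_pdivrMr //; lra.
have := ler_wpM2l y0 (expR_le_1D2x _ _ x0); lra.
Qed.

Theorem theorem2p3 (R : realType) (n : nat) (A : 'M[R[i]]_n)
    (hermA : A \is hermsymmx)
    (specA : forall a : R[i], eigenvalue A a -> -1 < a < 1)
    (mu alpha sigma : R) (alpha_gt0 : 0 < alpha) (sigma_gt0 : 0 < sigma) :
  let rho : R := (1 + alpha * sigma)^-1 in
  let K : R := 2 / (rho * alpha * sigma) * expR (alpha ^+ 2) in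
  forall i j : 'I_n,
    let d := geodist (induced_edge A) i j in
    geq_enat d 1 ->
    `| matfun (gauss sigma mu) A i j | <= (K * pow_enat rho d)%:C.
Proof.
move=> rho K i j d d1.
pose chi := 1 + alpha * sigma; pose T := ((chi + `|mu|) / sigma) ^+ 2.
have as0 : 0 < alpha * sigma by rewrite mulr_gt0.
have chi1 : 1 < chi by rewrite ltrDl.
have chi0 : 0 < chi := lt_trans ltr01 chi1.
have Anormal : A \is normalmx := hermitian_normalmx hermA.
have spec k : exists2 x : R, spectral_diag A 0 k = x%:C & -1 <= x <= 1.
  have /andP[lo up] := specA _ (spectral_diag_eigenvalue A k Anormal).
  have /complex_realP[x Dx] : spectral_diag A 0 k \is Num.real.
    by rewrite (ler_real (ltW up)) real1.
  exists x => //; move: lo up.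
  rewrite Dx -(rmorph1 (real_complex R)) -rmorphN !ltcR.
  by move=> /ltW -> /ltW ->.
set F := matfun _ A i j; pose a := complex.Re `|F|.
have aE : `|F| = a%:C by rewrite /a normc_def.
pose q m := gauss_poly sigma mu m.
have Fq m : (0 < m)%N -> T <= m%:R ->
    `|F - matfun (horner (q m)) A i j| <= (T ^+ 2 / m%:R)%:C.
  move=> m0 Tm; rewrite matfunB; apply: matfun_norm_le => k.
  have [x -> x1] := spec k.
  exact: gauss_poly_interval_approx (ltW chi1) x1 m0 Tm.
(* As [q_m(A)_ij] tends to [F], its bounds pass to the limit. *)
have limit b : 0 <= b -> (forall m, (0 < m)%N -> T <= m%:R ->
    `|matfun (horner (q m)) A i j|
      <= (b * expR (alpha ^+ 2 + T ^+ 2 / m%:R))%:C) ->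
    `|F| <= (b * expR (alpha ^+ 2))%:C.
  move=> b0 qb; rewrite aE lecR; apply: (ler_of_exp_harmonic _ _ _ _ T) => //.
    exact: sqr_ge0.
  move=> m m0 Tm; rewrite -lecR -aE rmorphD.
  rewrite -[F](subrK (matfun (horner (q m)) A i j)).
  by rewrite (le_trans (ler_normD _ _)) // lerD ?Fq ?qb.
case Dd: d d1 => [[//|k]|] _ /=; last first.
  rewrite mulr0 -(mul0r (expR (alpha ^+ 2))); apply: limit => // m _ _.
  by rewrite mul0r matfun_horner_far ?normr0 // -/d Dd.
have -> : K * rho ^+ k.+1 = 2 / (chi ^+ k * (chi - 1)) * expR (alpha ^+ 2).
  rewrite /K /rho -/chi exprVn (exprS chi).
  rewrite (_ : chi - 1 = alpha * sigma); last first.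
    by rewrite /chi; ring.
  by field; rewrite !gt_eqF // exprn_gt0.
apply: limit => [|m m0 Tm].
  by rewrite divr_ge0 // mulr_ge0 ?exprn_ge0 ?subr_ge0 ?ltW.
have chiC1 : 1 < chi%:C :> R[i] by rewrite -(rmorph1 (real_complex R)) ltcR.
have [w nw|p szp qp] := bernstein_approximation _ (q m) _
    (expR (alpha ^+ 2 + T ^+ 2 / m%:R))%:C k chiC1.
  exact: gauss_poly_ellipse_le.
have <- : matfun (horner (q m)) A i j - matfun (horner p) A i j
          = matfun (horner (q m)) A i j.
  have p0 : matfun (horner p) A i j = 0.
    by apply: matfun_horner_far Anormal _; rewrite -/d Dd.
  by rewrite [X in _ - X]p0 subr0.
rewrite matfunB; apply: matfun_norm_le => h; have [x -> /andP[lo up]] := spec h.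
apply: le_trans (qp _ _) _.
  by rewrite -(rmorph1 (real_complex R)) -rmorphN !lecR lo.
rewrite -(rmorph1 (real_complex R)) -(rmorph_nat (real_complex R)).
by rewrite -rmorphB -rmorphXn -!rmorphM -fmorphV -rmorphM lecR mulrAC.
Qed.
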